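(* Let $D$ be an $F_3$-free strict digraph on $n\ge 16$ vertices, with size $a(D)$. Then $$a(D)\le \left\lfloor \frac{n^2}{3}\right\rfloor+1,$$ with equality if and only if $D\in T_{3,n}$ (up to isomorphism).
   Context: Digraphs are finite and simple: there are no multiple arcs (at most one arc from $u$ to $v$ for each ordered pair $(u,v)$), but loops are allowed, and both $uv$ and $vu$ may be arcs. A strict digraph is a simple digraph without loops. The size $a(D)$ of a digraph $D$ is its number of arcs. A walk of length $k$ is a sequence of vertices $v_0v_1\cdots v_k$ (vertices may repeat) such that $v_{i-1}v_i$ is an arc for each $1\le i\le k$; $v_0$ is its initial vertex and $v_k$ its terminal vertex. $F_3$ is the family of digraphs consisting of two different walks of length $3$ with the same initial vertex and the same terminal vertex. A digraph is $F_3$-free if it contains no member of $F_3$ as a subgraph; that is, for all vertices $x,y$ (possibly $x=y$) there is at most one walk of length $3$ from $x$ to $y$. For pairwise disjoint finite sets $V_1,V_2,V_3$, $T(V_1,V_2,V_3)$ is the digraph with vertex set $V_1\cup V_2\cup V_3$ in which $xy$ is an arc if and only if $x\in V_i$, $y\in V_j$ with $i<j$. $D+e$ denotes the digraph obtained from $D$ by adding an arc $e$ (not already in $D$), where $e$ is allowed to be a loop. $T_{3,n}$ is the set of digraphs $T(V_1,V_2,V_3)+e$ such that $|V_1|+|V_2|+|V_3|=n$, $|V_i|\in\{\lfloor n/3\rfloor,\lceil n/3\rceil\}$ for $i=1,2,3$, and $e$ is an arc (possibly a loop) with both ends in $V_2$. (For a strict digraph to lie in $T_{3,n}$, the arc $e$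 must not be a loop.) *)

(* Defs.v *)
From mathcomp Require Import all_boot.

Set Implicit Arguments.
Unset Strict Implicit.
Unset Printing Implicit Defensive.

(* A digraph without multiple arcs on the vertex set V is a relation
   D : rel V, where D x y means that xy is an arc; loops are allowed. *)
Section Digraph.
Variable V : finType.
Implicit Types (D : rel V) (x y a b : V).

Definition strict D : Prop := irreflexive D.

Definition arc_number D : nat := #|[set p : V * V | D p.1 p.2]|.

(* The vertex sequence of the walk is x :: p. *)
Definition walk D (k : nat) x y (p : seq V) : bool :=
  [&& path D x p, size p == k & last x p == y].

Definition F3_free D : Prop :=
  forall x y (p q : seq V), walk D 3 x y p -> walk D 3 x y q -> p = q.

Definition transitive_tripartite (V1 V2 V3 : {set V}) : rel V :=
  [rel x y | [|| (x \in V1) && (y \in V2),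
                 (x \in V1) && (y \in V3) |
                 (x \in V2) && (y \in V3)]].

Definition add_arc D a b : rel V :=
  [rel x y | D x y || ((x == a) && (y == b))].

(* (n + 2) %/ 3 is the ceiling of n / 3. *)
Definition balanced_part (n : nat) (A : {set V}) : Prop :=
  #|A| = n %/ 3 \/ #|A| = (n + 2) %/ 3.

(* As a and b both lie in V2, the arc ab is not already in the tripartite
   digraph; a = b is allowed. *)
Definition in_T3 (n : nat) D : Prop :=
  exists V1 V2 V3 : {set V},
    [/\ [disjoint V1 & V2], [disjoint V1 & V3] & [disjoint V2 & V3]] /\
    V1 :|: V2 :|: V3 = [set: V] /\
    #|V1| + #|V2| + #|V3| = n /\
    [/\ balanced_part n V1, balanced_part n V2 & balanced_part n V3] /\
    exists a b, [/\ a \in V2, b \in V2 &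
                    D =2 add_arc (transitive_tripartite V1 V2 V3) a b].

End Digraph.

Definition isomorphic (V W : finType) (D : rel V) (H : rel W) : Prop :=
  exists2 f : V -> W, bijective f & forall x y, H (f x) (f y) = D x y.

(* Main.v *)
(** Write f(n) for the bound n^2/3 + 1, rounded down, and delete a vertex v of
    minimum total degree.  The degrees sum to 2 a(D), so a(D) >= f(n) forces
    a(D - v) >= f(n - 1); by induction D - v = T(V1, V2, V3) + ab, which has
    exactly f(n - 1) arcs, and v has degree at least 2n/3, rounded down.  Any
    s in V1 and t in V3 are already joined by the walk s a b t, so every further
    walk of length 3 from V1 to V3 is forbidden; this forces v to behave like a
    vertex of one of the three parts, and the degree of v then forces all the
    arcs between v and the other two parts.  For strict digraphs the induction
    can start at n = 6, where the digraphs with at least 13 arcs are found by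
    generating, one vertex at a time, all F_3-free digraphs with at least
    0, 1, 3, 6, 9, 13 arcs on 1, ..., 6 vertices up to isomorphism. *)

Require Import Defs.
From mathcomp Require Import all_boot.
From mathcomp Require Import zify.

Set Implicit Arguments.
Unset Strict Implicit.
Unset Printing Implicit Defensive.

(** * Degrees and arc counts in a vertex subset *)

Section Degree.
Variables (V : finType) (D : rel V).
Implicit Types (A : {set V}) (v x y : V).

Definition outN v A : {set V} := [set x in A | D v x].
Definition inN v A : {set V} := [set x in A | D x v].
Definition degree v A : nat := #|outN v A| + #|inN v A|.
Definition arcs_in A : nat := \sum_(x in A) \sum_(y in A) D x y.

Lemma card_outN v A : #|outN v A| = \sum_(x in A) D v x.
Proof.
rewrite -sum1_card big_mkcond [RHS]big_mkcond.
by apply: eq_bigr => x _; rewrite inE; case: (x \in A); case: (D v x).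
Qed.

Lemma card_inN v A : #|inN v A| = \sum_(x in A) D x v.
Proof.
rewrite -sum1_card big_mkcond [RHS]big_mkcond.
by apply: eq_bigr => x _; rewrite inE; case: (x \in A); case: (D x v).
Qed.

Lemma sum_degree A : \sum_(v in A) degree v A = 2 * arcs_in A.
Proof.
rewrite /degree big_split /= mul2n -addnn; congr (_ + _).
  by apply: eq_bigr => v _; rewrite card_outN.
rewrite /arcs_in exchange_big /=.
by apply: eq_bigr => v _; rewrite card_inN.
Qed.

(** The minimum degree is at most the average, and the degrees sum to twice the number of arcs. *)
Lemma exists_low_degree A :
  0 < #|A| -> exists2 v, v \in A & #|A| * degree v A <= 2 * arcs_in A.
Proof.
case/card_gt0P=> v0 v0A.
case: (@arg_minnP _ v0 (fun v => v \in A) (fun v => degree v A) v0A) => v vA le_v.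
exists v => //; rewrite -sum_degree -sum_nat_const.
by apply: leq_sum => x xA; apply: le_v.
Qed.

Lemma arcs_inD1 v A : irreflexive D -> v \in A ->
  arcs_in A = degree v A + arcs_in (A :\ v).
Proof.
move=> Dirr vA; rewrite /arcs_in (big_setD1 v vA) /= /degree -addnA card_outN.
congr (_ + _).
rewrite card_inN (big_setD1 v vA) /= Dirr add0n -big_split /=.
by apply: eq_bigr => x _; rewrite (big_setD1 v vA).
Qed.

Lemma degreeD1 v A : irreflexive D -> degree v (A :\ v) = degree v A.
Proof.
move=> Dirr; have neq x : (x != v) && D v x = D v x /\ (x != v) && D x v = D x v.
  by case: eqVneq => // ->; rewrite Dirr.
rewrite /degree; congr addn; apply: eq_card => x; rewrite !inE andbC andbA andbC.
  by rewrite [D v x && _]andbC (neq x).1.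
by rewrite [D x v && _]andbC (neq x).2.
Qed.

Lemma arcs_in_setT : arcs_in [set: V] = arc_number D.
Proof.
rewrite /arcs_in /arc_number -sum1_card pair_big /=.
rewrite big_mkcond [RHS]big_mkcond; apply: eq_bigr => -[x y] _.
by rewrite !inE /=; case: (D x y).
Qed.

End Degree.

Lemma F3_free_walk (V : finType) (D : rel V) (x y a b c d : V) : F3_free D ->
  D x a -> D a b -> D b y -> D x c -> D c d -> D d y -> a = c /\ b = d.
Proof.
move=> Dfree xa ab byy xc cd dy.
have := Dfree x y [:: a; b; y] [:: c; d; y].
by rewrite /walk /= xa ab byy xc cd dy eqxx => /(_ isT isT) [].
Qed.

(** * Adjacency matrices as lists of Boolean rows *)

Section AdjacencyMatrix.

Definition entry (M : seq (seq bool)) i j : bool := nth false (nth [::] M i) j.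

Definition nbarcs (M : seq (seq bool)) : nat := sumn [seq count id r | r <- M].

Definition row_support (r : seq bool) : seq nat :=
  [seq j <- iota 0 (size r) | nth false r j].

(** One entry per walk of length 3 from [i], so a repetition is a pair of different walks with the
    same ends. *)
Definition walk_ends (M : seq (seq bool)) (i : nat) : seq nat :=
  let out j := row_support (nth [::] M j) in
  flatten [seq flatten [seq out k | k <- out j] | j <- out i].

Definition F3_freeb (M : seq (seq bool)) : bool :=
  all (fun i => uniq (walk_ends M i)) (iota 0 (size M)).

Definition permute (M : seq (seq bool)) (p : seq nat) : seq (seq bool) :=
  [seq [seq entry M i j | j <- p] | i <- p].

(** The new vertex receives index 0; [ins] is its column, [outs] its row. *)
Definition extend (M : seq (seq bool)) (ins outs : seq bool) : seq (seq bool) :=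
  (false :: outs) :: [seq r.1 :: r.2 | r <- zip ins M].

Fixpoint bitseqs k : seq (seq bool) :=
  if k is k'.+1 then
    [seq true :: s | s <- bitseqs k'] ++ [seq false :: s | s <- bitseqs k']
  else [:: [::]].

Lemma mem_bitseqs (s : seq bool) : s \in bitseqs (size s).
Proof.
by elim: s => //= -[] s IHs; rewrite mem_cat map_f ?orbT.
Qed.

Variables (V : finType) (D : rel V).

Definition adjm (s : seq V) : seq (seq bool) :=
  [seq [seq D x y | y <- s] | x <- s].

Lemma entry_adjm x0 s i j : i < size s -> j < size s ->
  entry (adjm s) i j = D (nth x0 s i) (nth x0 s j).
Proof.
by move=> ltis ltjs; rewrite /entry (nth_map x0) // (nth_map x0).
Qed.

Lemma permute_adjm x0 s p : {subset p <= iota 0 (size s)} ->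
  permute (adjm s) p = adjm [seq nth x0 s i | i <- p].
Proof.
move=> sub_p; have lt_p i : i \in p -> i < size s.
  by move/sub_p; rewrite mem_iota.
rewrite /adjm /permute -map_comp; apply/eq_in_map => i /lt_p lti /=.
rewrite -map_comp; apply/eq_in_map => j /lt_p ltj /=.
exact: entry_adjm.
Qed.

Lemma adjm_cons v s : irreflexive D ->
  adjm (v :: s) = extend (adjm s) [seq D x v | x <- s] [seq D v x | x <- s].
Proof.
move=> Dirr; rewrite /adjm /extend /= Dirr; congr (_ :: _).
by rewrite zip_map -map_comp.
Qed.

Lemma nbarcs_adjm s : uniq s -> nbarcs (adjm s) = arcs_in D [set x in s].
Proof.
move=> Us; rewrite /nbarcs /arcs_in sumnE -map_comp big_map.
have in_s F : \sum_(x <- s) F x = \sum_(x in [set x in s]) F x.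
  by rewrite big_uniq //; apply: eq_bigl => x; rewrite inE.
rewrite in_s; apply: eq_bigr => x _ /=.
by rewrite count_map -sum1_count big_mkcond /= in_s; apply: eq_bigr => y _; case: (D x y).
Qed.

Lemma F3_freeb_adjm s : F3_free D -> uniq s -> F3_freeb (adjm s).
Proof.
move=> Dfree Us; apply/allP => i; rewrite size_map mem_iota => /= ltis.
case: s Us ltis => // x0 s0; set s := x0 :: s0 => Us ltis.
pose out j := row_support (nth [::] (adjm s) j).
have Uout j : uniq (out j) by rewrite filter_uniq ?iota_uniq.
have outP j k : j < size s -> k \in out j ->
    k < size s /\ D (nth x0 s j) (nth x0 s k).
  move=> ltjs; rewrite mem_filter mem_iota /= (nth_map x0) // size_map.
  by case/andP=> + ltks; rewrite (nth_map x0).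
(* [W] lists the walks from [i] with all their later vertices, without repetition; $F_3$-freeness
   makes the projection to the last vertex injective on it. *)
pose W := [seq ((j, kl.1), kl.2) | j <- out i,
             kl <- [seq (k, l) | k <- out j, l <- out k]].
have WP w : w \in W -> [/\ D (nth x0 s i) (nth x0 s w.1.1),
    D (nth x0 s w.1.1) (nth x0 s w.1.2), D (nth x0 s w.1.2) (nth x0 s w.2) &
    [/\ w.1.1 < size s, w.1.2 < size s & w.2 < size s]].
  case/allpairsPdep=> j [kl [/(outP _ _ ltis) [ltj ij] + ->]] /=.
  case/allpairsPdep=> k [l [/(outP _ _ ltj) [ltk jk] /(outP _ _ ltk) [ltl kl'] ->]] /=.
  by [].
have -> : walk_ends (adjm s) i = [seq w.2 | w <- W].
  rewrite /walk_ends -/out /W map_flatten -map_comp; congr flatten.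
  apply/eq_map => j /=; rewrite -map_comp map_flatten -map_comp; congr flatten.
  by apply/eq_map => k /=; rewrite -map_comp map_id.
rewrite map_inj_in_uniq.
  apply: allpairs_uniq_dep => //.
    move=> j _; apply: allpairs_uniq_dep => //.
    by move=> [k l] [k' l'] _ _ /= [-> ->].
  by move=> [j [k l]] [j' [k' l']] _ _ /= [-> -> ->].
move=> [[j k] l] [[j' k'] l'] /WP /= [ij jk kl [ltj ltk ltl]].
move=> /WP /= [ij' jk' kl' [ltj' ltk' ltl']] ll'; subst l'.
case: (F3_free_walk Dfree ij jk kl ij' jk' kl') => /eqP + /eqP.
by rewrite !nth_uniq // => /eqP -> /eqP ->.
Qed.

End AdjacencyMatrix.

(** * Generation of small digraphs up to isomorphism *)

Definition insert_class (n : nat) (M : seq (seq bool)) (L : seq (seq (seq bool))) :=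
  if has (fun p => permute M p \in L) (permutations (iota 0 n)) then L else M :: L.

(* A lower bound on the number of arcs left when vertices of minimum degree are
   deleted one at a time, starting from 6 vertices and at least 13 arcs. *)
Definition threshold (n : nat) : nat := nth 0 [:: 0; 0; 1; 3; 6; 9; 13] n.

Definition extensions (n : nat) (L : seq (seq (seq bool))) :=
  [seq extend M rs.1 rs.2 | M <- L,
     rs <- [seq (r, s) | r <- bitseqs n, s <- bitseqs n]].

Fixpoint classes (n : nat) : seq (seq (seq bool)) :=
  match n with
  | 0 => [:: [::]]
  | n'.+1 =>
    foldr (insert_class n) [::]
      (filter F3_freeb
        (filter (fun M => threshold n <= nbarcs M) (extensions n' (classes n'))))
  end.

(** A matrix is dropped only when a relabelling of it is already listed, and insertions never remove
    anything. The condition on [iota 0 n] says that [M] is an n by n matrix, hence its own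
    relabelling when it is kept. *)
Lemma insert_classP n M L : M \in L -> permute M (iota 0 n) = M ->
  exists2 p, perm_eq p (iota 0 n) & permute M p \in foldr (insert_class n) [::] L.
Proof.
move=> + idM; elim: L => //= N L IHL; rewrite inE => MNL.
have [eqMN | neqMN] := eqVneq M N.
  rewrite -eqMN /insert_class; case: ifPn => [/hasP [p] | _].
    by rewrite mem_permutations => pP pL; exists p.
  by exists (iota 0 n); rewrite // idM inE eqxx.
case: IHL => [|p pP pL]; first by move: MNL; rewrite (negPf neqMN).
by exists p => //; rewrite /insert_class; case: ifP => // _; rewrite inE pL orbT.
Qed.

(** The survivor is the tripartite digraph with parts {1, 2}, {3, 4}, {0, 5}, in this order, plus
    the arc from 3 to 4. *)
Lemma classes6 : classes 6 =
  [:: [:: [:: false; false; false; false; false; false];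
          [:: true; false; false; true; true; true];
          [:: true; false; false; true; true; true];
          [:: true; false; false; false; true; true];
          [:: true; false; false; false; false; true];
          [:: false; false; false; false; false; false]]].
Proof. by vm_compute. Qed.

(** * Arithmetic of the extremal number *)

Lemma sqr_divn3 n : (n ^ 2 %/ 3 * 3 <= n ^ 2) && (n ^ 2 <= n ^ 2 %/ 3 * 3 + 1).
Proof.
have [q [r [-> r3]]] : exists q r, n = q * 3 + r /\ r < 3.
  by exists (n %/ 3), (n %% 3); rewrite -divn_eq ltn_mod.
have -> : (q * 3 + r) ^ 2 = (3 * q ^ 2 + 2 * q * r) * 3 + r ^ 2 by rewrite !expnS; nia.
by rewrite divnMDl //; case: r r3 => [|[|[|r]]] // _; rewrite /expn /=; lia.
Qed.

(** Here [d] is the degree of the vertex deleted from [m.+1] vertices and [a] the number of arcs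
    left. If [a] were at most m^2/3, the bound on [d + a] would give 3d >= 2m + 3, while the low
    degree gives 3(m - 1)d <= 2m^2; together m <= 3. *)
Lemma deletion_bound m a d : 4 <= m -> m.+1 * d <= 2 * (d + a) ->
  m.+1 ^ 2 %/ 3 + 1 <= d + a -> m ^ 2 %/ 3 + 1 <= a.
Proof.
move=> m4 low; have := sqr_divn3 m; have := sqr_divn3 m.+1.
set q := m.+1 ^ 2 %/ 3; set q' := m ^ 2 %/ 3; rewrite !expnS !expn0 !muln1.
move=> /andP [_ q_lb] /andP [q'_ub _] le_q; rewrite leqNgt; apply/negP=> lt_a.
have d_lb : 2 * m + 3 <= 3 * d by lia.
have d_ub : 3 * ((m - 1) * d) <= 2 * (m * m) by nia.
have : (m - 1) * (2 * m + 3) <= (m - 1) * (3 * d) by rewrite leq_mul2l d_lb orbT.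
by nia.
Qed.

(** Squares are 0 or 1 modulo 3, so 3d >= (m + 1)^2 - 1 - m^2 = 2m; [(2 * m + 2) %/ 3] is 2m/3
    rounded up. *)
Lemma degree_bound m a d : a = m ^ 2 %/ 3 + 1 ->
  m.+1 ^ 2 %/ 3 + 1 <= d + a -> (2 * m + 2) %/ 3 <= d.
Proof.
move=> ->; have := sqr_divn3 m; have := sqr_divn3 m.+1.
set q := m.+1 ^ 2 %/ 3; set q' := m ^ 2 %/ 3; rewrite !expnS !expn0 !muln1.
by lia.
Qed.

(** With n = 3q + r, the sum forces exactly r parts of size q + 1 and the others of size q. *)
Lemma turan3 n n0 n1 n2 : n0 + n1 + n2 = n ->
  n0 = n %/ 3 \/ n0 = (n + 2) %/ 3 -> n1 = n %/ 3 \/ n1 = (n + 2) %/ 3 ->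
  n2 = n %/ 3 \/ n2 = (n + 2) %/ 3 -> n0 * n1 + n0 * n2 + n1 * n2 = n ^ 2 %/ 3.
Proof.
move=> sum b0 b1 b2; have := sqr_divn3 n.
have [q [r [nE r3]]] : exists q r, n = q * 3 + r /\ r < 3.
  by exists (n %/ 3), (n %% 3); rewrite -divn_eq ltn_mod.
set f := n ^ 2 %/ 3; rewrite expnS expn1; move: f sum; rewrite nE => f.
have {}b0 : n0 = q \/ n0 = q.+1 by lia.
have {}b1 : n1 = q \/ n1 = q.+1 by lia.
have {}b2 : n2 = q \/ n2 = q.+1 by lia.
have {r3 nE} : r = 0 \/ r = 1 \/ r = 2 by lia.
by case: b0 => ->; case: b1 => ->; case: b2 => ->; case=> [|[]] ->; clear; nia.
Qed.

(** * Tripartitions as vertex colourings *)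

Section Colouring.
Variables (V : finType) (c : V -> nat).
Implicit Type A : {set V}.

Definition colour_class A i : {set V} := [set x in A | c x == i].

Lemma card_colour_class A i : #|colour_class A i| = \sum_(x in A) (c x == i).
Proof.
rewrite -sum1_card big_mkcond [RHS]big_mkcond.
by apply: eq_bigr => x _; rewrite inE; case: (x \in A); case: (c x == i).
Qed.

Lemma card_colour_classes A : {in A, forall x, c x < 3} ->
  #|colour_class A 0| + #|colour_class A 1| + #|colour_class A 2| = #|A|.
Proof.
move=> c3; rewrite !card_colour_class -!big_split /= -sum1_card.
by apply: eq_bigr => x /c3; case: (c x) => [|[|[|k]]].
Qed.

End Colouring.

Section TripartiteColouring.
Variables (V : finType) (D : rel V).
Implicit Type A : {set V}.

(* [c x = i] encodes that [x] lies in the part [V_(i + 1)]. *)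
Definition T3_on A : Prop :=
  exists (c : V -> nat) (a b : V),
    [/\ {in A, forall x, c x < 3},
        forall i, i < 3 -> balanced_part #|A| (colour_class c A i),
        a \in colour_class c A 1, b \in colour_class c A 1 &
        {in A &, forall x y, D x y = (c x < c y) || ((x == a) && (y == b))}].

(** The arc [ab] lies inside one colour class, so the indicator of an arc is the sum of three
    products of class indicators and the indicator of [ab]. *)
Lemma arcs_in_T3 A : T3_on A -> arcs_in D A = #|A| ^ 2 %/ 3 + 1.
Proof.
case=> c [a [b [c3 bal]]]; rewrite !inE => /andP [aA /eqP ca] /andP [bA /eqP cb] DE.
have [b0 b1 b2] := And3 (bal 0 isT) (bal 1 isT) (bal 2 isT).
rewrite -(turan3 (card_colour_classes c3) b0 b1 b2) !card_colour_class !big_distrlr /=.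
rewrite -!big_split /=.
have ab1 : \sum_(x in A) \sum_(y in A) (x == a) * (y == b) = 1.
  rewrite -big_distrlr /=.
  have sum1 z : z \in A -> \sum_(x in A) (x == z) = 1.
    move=> zA; rewrite (bigD1 z) //= eqxx big1 ?addn0 // => x /andP [_ /negPf ->] //.
  by rewrite !sum1.
(* The 1 becomes a double sum, so that both sides compare term by term. *)
rewrite -[X in _ = _ + X]ab1.
rewrite -big_split; apply: eq_bigr => x xA; rewrite -!big_split.
apply: eq_bigr => y yA /=.
rewrite DE //.
have [-> /= | _] := eqVneq x a; last first.
  rewrite orbF addn0; move: (c3 x xA) (c3 y yA).
  by case: (c x) => [|[|[|]]] //; case: (c y) => [|[|[|]]].
have [-> /= | _] := eqVneq y b; first by rewrite ca cb.
by rewrite orbF addn0 ca; move: (c3 y yA); case: (c y) => [|[|[|]]].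
Qed.

Lemma in_T3P n : #|V| = n -> in_T3 n D <-> T3_on [set: V].
Proof.
move=> cardV; rewrite /T3_on cardsT cardV; split.
  case=> V1 [V2 [V3 [[d12 d13 d23] [cover [_ [[b1 b2 b3] [a [b [a2 b2' DE]]]]]]]]].
  pose c x := if x \in V1 then 0 else if x \in V2 then 1 else 2.
  have disjF (B C : {set V}) x : [disjoint B & C] -> ~~ ((x \in B) && (x \in C)).
    by move=> dBC; apply/negP=> /andP [/(disjointFr dBC) ->].
  have cE x :
      [/\ (c x == 0) = (x \in V1), (c x == 1) = (x \in V2) & (c x == 2) = (x \in V3)].
    have : x \in V1 :|: V2 :|: V3 by rewrite cover.
    move: (disjF _ _ x d12) (disjF _ _ x d13) (disjF _ _ x d23); rewrite !inE /c.
    by case: (x \in V1); case: (x \in V2); case: (x \in V3).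
  have classE i (B : {set V}) : (forall x, (c x == i) = (x \in B)) -> colour_class c [set: V] i = B.
    by move=> iB; apply/setP=> x; rewrite !inE iB.
  have c1 := classE 0 V1 (fun x => let: And3 h _ _ := cE x in h).
  have c2 := classE 1 V2 (fun x => let: And3 _ h _ := cE x in h).
  have c3 := classE 2 V3 (fun x => let: And3 _ _ h := cE x in h).
  exists c, a, b; rewrite c2; split=> //.
  - by move=> x _; rewrite /c; case: ifP => // _; case: ifP.
  - by case=> [|[|[|]]] // _; rewrite ?c1 ?c2 ?c3.
  move=> x y _ _; rewrite DE /add_arc /transitive_tripartite /=.
  congr (_ || _); have [<- <- _] := cE x; have [_ <- <-] := cE y.
  have [x3 y3] : c x < 3 /\ c y < 3 by rewrite /c; do !case: ifP.
  by case: (c x) x3 => [|[|[|]]] //; case: (c y) y3 => [|[|[|]]].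
case=> c [a [b [c3 bal a1 b1 DE]]].
have card := card_colour_classes c3.
exists (colour_class c [set: V] 0), (colour_class c [set: V] 1),
  (colour_class c [set: V] 2).
have dis i j : i != j -> [disjoint colour_class c [set: V] i & colour_class c [set: V] j].
  move=> neq_ij; rewrite -setI_eq0; apply/eqP/setP=> x; rewrite !inE.
  by apply: contraNF neq_ij => /andP [/eqP <-].
split; first by split; apply: dis.
split.
  by apply/setP=> x; rewrite !inE; have := c3 x (in_setT x); case: (c x) => [|[|[|]]].
split; first by rewrite card cardsT.
split; first by split; apply: bal.
exists a, b; split=> // x y.
rewrite DE ?inE // /add_arc /transitive_tripartite /= !inE; congr (_ || _).
have := c3 x (in_setT x); have := c3 y (in_setT y).
by case: (c x) => [|[|[|]]] //; case: (c y) => [|[|[|]]].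
Qed.

End TripartiteColouring.

(** * Extremal digraphs by vertex deletion *)

Section Extremal.
Variables (V : finType) (D : rel V).
Hypotheses (Dirr : irreflexive D) (Dfree : F3_free D).
Implicit Types (A : {set V}) (v x y : V).

Lemma exists_deletion A : 0 < #|A| -> exists v,
  [/\ v \in A, #|A| = #|A :\ v|.+1, degree D v (A :\ v) = degree D v A,
      arcs_in D A = degree D v A + arcs_in D (A :\ v)
    & #|A| * degree D v A <= 2 * arcs_in D A].
Proof.
case/(exists_low_degree D)=> v vA low; exists v.
split=> //; [by rewrite [LHS](cardsD1 v) vA | exact: degreeD1 | exact: arcs_inD1].
Qed.

(** Delete a vertex of low degree, enumerate the rest by induction and put the vertex in front: the
    resulting matrix is among the [extensions], and its listed relabelling is the matrix of a
    permuted enumeration. *)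
Lemma classes_complete n A : n <= 6 -> #|A| = n -> threshold n <= arcs_in D A ->
  exists s, [/\ uniq s, [set x in s] = A & adjm D s \in classes n].
Proof.
elim: n A => [|n IHn] A le_n6 cardA arcsA.
  by exists [::]; split=> //; apply/esym/eqP; rewrite -cards_eq0 cardA.
have [|v [vA cardA' _ arcsA' low]] := @exists_deletion A; first by rewrite cardA.
have [|||s [Us sA sL]] := IHn (A :\ v).
- exact: ltnW.
- by lia.
(* The deleted degree is at most 2/(n + 1) times the number of arcs; each n is checked
   separately. *)
- move: low arcsA arcsA' le_n6; rewrite cardA /threshold; clear.
  by case: n => [|[|[|[|[|[|n]]]]]] /=; lia.
have mem_s x : (x \in s) = (x != v) && (x \in A).
  by move/setP/(_ x): sA; rewrite !inE.
have svA x : (x \in v :: s) = (x \in A) by rewrite inE mem_s; case: eqVneq => // ->.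
have Uvs : uniq (v :: s) by rewrite /= Us mem_s eqxx.
have size_s : size s = n.
  have cardAv : #|A :\ v| = n by lia.
  by rewrite -(card_uniqP Us) -cardAv -sA; apply: eq_card => x; rewrite inE.
have vsA : [set x in v :: s] = A by apply/setP=> x; rewrite inE svA.
have [||p pP pL] := @insert_classP n.+1 (adjm D (v :: s))
    (filter F3_freeb (filter (fun M => threshold n.+1 <= nbarcs M)
                        (extensions n (classes n)))).
- rewrite !mem_filter F3_freeb_adjm // nbarcs_adjm // vsA arcsA /=.
  rewrite adjm_cons //; set r := [seq D x v | x <- s]; set t := map (D v) s.
  apply: (allpairs_f (fun M rs => extend M rs.1 rs.2) (y := (r, t)) sL).
  apply: (allpairs_f pair); rewrite -size_s -(size_map (D v) s).
    by rewrite size_map -(size_map (fun x => D x v) s) mem_bitseqs.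
  exact: mem_bitseqs.
- have -> : n.+1 = size (v :: s) by rewrite /= size_s.
  by rewrite (permute_adjm D v) // -/(mkseq _ _) mkseq_nth.
have p_size i : i \in p -> i < size (v :: s).
  by rewrite (perm_mem pP) mem_iota /= size_s.
exists [seq nth v (v :: s) i | i <- p].
have perm_s : perm_eq [seq nth v (v :: s) i | i <- p] (v :: s).
  rewrite -[X in perm_eq _ X](mkseq_nth v); apply: perm_map.
  by rewrite /= size_s.
split; first by rewrite (perm_uniq perm_s).
  by apply/setP=> x; rewrite inE (perm_mem perm_s) svA.
by rewrite -permute_adjm // => i /p_size; rewrite mem_iota.
Qed.

Lemma T3_on_card6 A : #|A| = 6 -> 13 <= arcs_in D A -> T3_on D A.
Proof.
move=> cardA arcsA.
have [s [Us sA sL]] := classes_complete (leqnn 6) cardA arcsA.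
move: sL; rewrite classes6 inE; set M := (X in adjm D s == X) => /eqP sM.
have [x0 x0A] : exists x0, x0 \in A by apply/card_gt0P; rewrite cardA.
have size_s : size s = 6 by have := congr1 size sM; rewrite size_map.
pose z i := nth x0 s i.
have zE i j : i < 6 -> j < 6 -> (z i == z j) = (i == j).
  by move=> lti ltj; rewrite nth_uniq ?size_s.
have zA i : i < 6 -> z i \in A by move=> lti; rewrite -sA inE mem_nth ?size_s.
have zP x : x \in A -> exists2 i, i < 6 & x = z i.
  rewrite -sA inE => xs; exists (index x s).
    by rewrite -size_s index_mem.
  by rewrite /z nth_index.
have DE i j : i < 6 -> j < 6 -> D (z i) (z j) = entry M i j.
  by move=> lti ltj; rewrite -sM (entry_adjm _ x0) ?size_s.
(* Colours of the six indices, read off the matrix of [classes6]; [z 3] and [z 4] will be the ends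
   of the extra arc. *)
pose col i := nth 0 [:: 2; 0; 0; 1; 1; 2] i.
pose c x := col (index x s).
have cz i : i < 6 -> c (z i) = col i by move=> lti; rewrite /c /z index_uniq ?size_s.
exists c, (z 3), (z 4); split; rewrite ?inE ?zA ?cz //.
- by move=> _ /zP [i lti ->]; rewrite cz //; case: i lti => [|[|[|[|[|[|i]]]]]].
- move=> k ltk; left; rewrite cardA.
  have -> : colour_class c A k = [set x in [seq z i | i <- iota 0 6 & col i == k]].
    apply/setP=> x; rewrite !inE; apply/andP/mapP.
      case=> /zP [i lti ->]; rewrite cz // => ck; exists i => //.
      by rewrite mem_filter ck mem_iota.
    by case=> i; rewrite mem_filter mem_iota => /andP [ck lti] ->; rewrite cz ?zA.
  rewrite cardsE; have /card_uniqP -> : uniq [seq z i | i <- iota 0 6 & col i == k].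
    rewrite map_inj_in_uniq ?filter_uniq ?iota_uniq // => i j.
    rewrite !mem_filter !mem_iota => /andP [_ lti] /andP [_ ltj] /eqP.
    by rewrite zE // => /eqP.
  by rewrite size_map; case: k ltk => [|[|[|k]]].
move=> _ _ /zP [i lti ->] /zP [j ltj ->]; rewrite DE // !cz // !zE //.
by case: i lti => [|[|[|[|[|[|i]]]]]] // _; case: j ltj => [|[|[|[|[|[|j]]]]]].
Qed.

(** The neighbours of [v] avoid class [k], and none is both an in- and an out-neighbour. The degree
    bound, 2|A|/3 rounded up, therefore makes class [k] a smallest one and joins [v] to its whole
    complement, in the only direction allowed. *)
Lemma T3_on_join A v (c : V -> nat) a b k :
  v \notin A -> (2 * #|A| + 2) %/ 3 <= degree D v A ->
  {in A, forall x, c x < 3} ->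
  (forall i, i < 3 -> balanced_part #|A| (colour_class c A i)) ->
  a \in colour_class c A 1 -> b \in colour_class c A 1 ->
  {in A &, forall x y, D x y = (c x < c y) || ((x == a) && (y == b))} ->
  k < 3 ->
  {in A, forall x, D v x -> k < c x} -> {in A, forall x, D x v -> c x < k} ->
  T3_on D (v |: A).
Proof.
move=> vA degv c3 bal aP bP DE k3 outk ink.
set O := outN D v A; set I := inN D v A; set K := colour_class c A k.
have KA : K \subset A by apply/subsetP=> x; rewrite inE => /andP [].
have dOI : [disjoint O & I].
  rewrite -setI_eq0; apply/eqP/setP=> x; rewrite !inE.
  apply/negP=> /andP [/andP [xA vx] /andP [_ xv]].
  by have := ltn_trans (outk x xA vx) (ink x xA xv); rewrite ltnn.
have OI_sub : O :|: I \subset A :\: K.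
  apply/subsetP=> x; rewrite !inE -andb_orr => /andP [xA].
  by rewrite xA andbT /=; case/orP=> [/(outk x xA)|/(ink x xA)]; case: ltngtP.
have cardOI : #|O :|: I| = degree D v A.
  by rewrite cardsU (disjoint_setI0 dOI) cards0 subn0.
have cardK : #|A :\: K| = #|A| - #|K| by rewrite cardsD (setIidPr KA).
have leOI := subset_leq_card OI_sub.
have cards := card_colour_classes c3.
have bal0 := bal 0 isT; have bal1 := bal 1 isT; have bal2 := bal 2 isT.
(* The complement of [K] has at least 2|A|/3 vertices, so [K] must take the rounded down size; this
   leaves room for [v]. *)
have [cardK' leDK] : #|K| = #|A| %/ 3 /\ #|A :\: K| <= degree D v A.
  have leKA := subset_leq_card KA.
  move: leKA (bal k k3) bal0 bal1 bal2 leOI cardK cards degv.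
  by rewrite /balanced_part -/K cardOI; clear; lia.
have OIE : O :|: I = A :\: K by apply/eqP; rewrite eqEcard OI_sub cardOI.
have OI_in x : x \in A -> c x != k -> D v x || D x v.
  by move=> xA cx; move/setP/(_ x): OIE; rewrite !inE xA cx.
have out_vE x : x \in A -> D v x = (k < c x).
  move=> xA; apply/idP/idP => [/outk-> // | kx].
  have /orP [//|/(ink x xA)] : D v x || D x v by rewrite OI_in // gtn_eqF.
  by rewrite ltnNge ltnW.
have in_vE x : x \in A -> D x v = (c x < k).
  move=> xA; apply/idP/idP => [/ink-> // | xk].
  have /orP [/(outk x xA)|//] : D v x || D x v by rewrite OI_in // ltn_eqF.
  by rewrite ltnNge ltnW.
have neqA x : x \in A -> (x == v) = false by move=> xA; apply: contraNF vA => /eqP <-.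
have [aA bA] : a \in A /\ b \in A.
  by move: aP bP; rewrite !inE => /andP [-> _] /andP [-> _].
pose c' x := if x == v then k else c x.
have c'v : c' v = k by rewrite /c' eqxx.
have c'A x : x \in A -> c' x = c x by move=> xA; rewrite /c' neqA.
exists c', a, b; split.
- by move=> x /setU1P [-> | xA]; rewrite ?c'v // c'A // c3.
- move=> i lti; rewrite /balanced_part cardsU1 vA.
  have -> : #|colour_class c' (v |: A) i| = (k == i) + #|colour_class c A i|.
    rewrite !card_colour_class big_setU1 //= c'v; congr (_ + _).
    by apply: eq_bigr => x /c'A ->.
  move: bal0 bal1 bal2 cards cardK'; rewrite /balanced_part /K; clear -lti k3.
  by case: k k3 => [|[|[|]]] // _; case: i lti => [|[|[|]]] //= _; lia.
- by rewrite inE c'A // !inE aA orbT; move: aP; rewrite inE aA.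
- by rewrite inE c'A // !inE bA orbT; move: bP; rewrite inE bA.
move=> x y /setU1P [-> | xA] /setU1P [-> | yA].
- by rewrite Dirr ltnn eq_sym neqA.
- by rewrite c'v c'A // out_vE // eq_sym neqA ?orbF.
- by rewrite c'v c'A // in_vE // [v == b]eq_sym neqA ?andbF ?orbF.
- by rewrite !c'A // DE.
Qed.

(** [T3_on_join] applies, with [k] decided by whether [v] has an in-neighbour in the first part and
    an out-neighbour in the third. If it has neither, all its neighbours lie in the middle part and
    are too few. *)
Lemma T3_on_extend A v : v \notin A -> 6 <= #|A| ->
  (2 * #|A| + 2) %/ 3 <= degree D v A -> T3_on D A -> T3_on D (v |: A).
Proof.
move=> vA A6 degv [c [a [b [c3 bal aP bP DE]]]].
have bal0 := bal 0 isT; have bal1 := bal 1 isT; have bal2 := bal 2 isT.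
have join k := @T3_on_join A v c a b k vA degv c3 bal aP bP DE.
move: (aP) (bP); rewrite !inE => /andP [aA /eqP ca] /andP [bA /eqP cb].
have lt_arc x y : x \in A -> y \in A -> c x < c y -> D x y.
  by move=> xA yA lt_xy; rewrite DE // lt_xy.
have ab : D a b by rewrite DE // !eqxx orbT.
have neq_ab : a <> b by move=> eq_ab; move: ab; rewrite eq_ab Dirr.
have neqA x : x \in A -> v <> x by move=> xA vx; move: vA; rewrite vx xA.
have [s sA cs] : exists2 s, s \in A & c s = 0.
  have /card_gt0P [s] : 0 < #|colour_class c A 0|.
    by move: bal0 A6; rewrite /balanced_part; clear; lia.
  by rewrite inE => /andP [sA /eqP cs]; exists s.
have [t tA ct] : exists2 t, t \in A & c t = 2.
  have /card_gt0P [t] : 0 < #|colour_class c A 2|.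
    by move: bal2 A6; rewrite /balanced_part; clear; lia.
  by rewrite inE => /andP [tA /eqP ct]; exists t.
(* The walk [x a b y] is already present. *)
have through_ab x y p q : x \in A -> y \in A -> c x = 0 -> c y = 2 ->
    D x p -> D p q -> D q y -> a = p /\ b = q.
  move=> xA yA cx cy; apply: (F3_free_walk Dfree _ ab);
  by apply: lt_arc => //; rewrite ?cx ?cy ?ca ?cb.
(* Otherwise [v x a y] and [v x b y] are different walks. *)
have no_out0 x y : D v x -> x \in A -> c x = 0 -> y \in A -> c y = 2 -> False.
  move=> vx xA cx yA cy.
  case: (@F3_free_walk _ D v y x a x b Dfree) => //;
  by apply: lt_arc => //; rewrite ?cx ?cy ?ca ?cb.
have no_in2 x y : D x v -> x \in A -> c x = 2 -> y \in A -> c y = 0 -> False.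
  move=> xv xA cx yA cy.
  case: (@F3_free_walk _ D y v a x b x Dfree) => //;
  by apply: lt_arc => //; rewrite ?cx ?cy ?ca ?cb.
have cases3 x : x \in A -> [\/ c x = 0, c x = 1 | c x = 2].
  move/c3; case: (c x) => [|[|[|i]]] // _; by [constructor 1|constructor 2|constructor 3].
have out0 x : x \in A -> D v x -> c x <> 0 by move=> xA vx cx; apply: (no_out0 x t).
have in2 x : x \in A -> D x v -> c x <> 2 by move=> xA xv cx; apply: (no_in2 x s).
(* For [y] in the middle part, the walk [x v y t] would force [v = a], but [v] is outside [A]. *)
have out2 x y : x \in A -> y \in A -> c x = 0 -> D x v -> D v y -> c y = 2.
  move=> xA yA cx xv vy; case: (cases3 y yA) => // cy; first by case: (out0 y).
  have yt : D y t by apply: lt_arc; rewrite ?cy ?ct.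
  by have [/esym/(neqA a aA)] := through_ab x t v y xA tA cx ct xv vy yt.
have in0 x y : x \in A -> y \in A -> c y = 2 -> D x v -> D v y -> c x = 0.
  move=> xA yA cy xv vy; case: (cases3 x xA) => // cx; last by case: (in2 x).
  have sx : D s x by apply: lt_arc; rewrite ?cs ?cx.
  by have [_ /esym/(neqA b bA)] := through_ab s y x v sA yA cs cy sx xv vy.
(* The four cases put [v], in order, in the middle, last and first part; the fourth is
   contradictory. *)
have [/exists_inP [x0 x0A /andP [/eqP cx0 x0v]] | /exists_inPn no_x0] :=
    boolP [exists x in A, (c x == 0) && D x v];
  have [/exists_inP [y0 y0A /andP [/eqP cy0 vy0]] | /exists_inPn no_y0] :=
    boolP [exists y in A, (c y == 2) && D v y].
- apply: (join 1) => // x xA.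
    by move/(out2 x0 x x0A xA cx0 x0v) => ->.
  by move/in0 => /(_ y0 xA y0A cy0 vy0) ->.
- apply: (join 2) => // x xA.
    by move=> vx; have := no_y0 x xA; rewrite vx (out2 x0 x).
  by move=> xv; case: (cases3 x xA) => cx; rewrite ?cx //; case: (in2 x).
- apply: (join 0) => // x xA.
    by move=> vx; case: (cases3 x xA) => cx; rewrite ?cx //; case: (out0 x).
  by move=> xv; have := no_x0 x xA; rewrite xv (in0 x y0).
have out1 x : x \in A -> D v x -> c x = 1.
  move=> xA vx; case: (cases3 x xA) => // cx; first by case: (out0 x).
  by have := no_y0 x xA; rewrite vx cx.
have in1 x : x \in A -> D x v -> c x = 1.
  move=> xA xv; case: (cases3 x xA) => // cx; last by case: (in2 x).
  by have := no_x0 x xA; rewrite xv cx.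
have subO : outN D v A \subset colour_class c A 1.
  by apply/subsetP=> x; rewrite !inE => /andP [xA /(out1 x xA) ->]; rewrite xA.
have subI : inN D v A \subset colour_class c A 1.
  by apply/subsetP=> x; rewrite !inE => /andP [xA /(in1 x xA) ->]; rewrite xA.
move: degv A6 bal1 (subset_leq_card subO) (subset_leq_card subI).
rewrite /balanced_part /degree => degv A6' bal1' leO leI.
(* If [v] has no out-neighbours or no in-neighbours, its degree is at most the size of one part,
   below 2|A|/3. *)
have [O0 | [w]] := set_0Vmem (outN D v A).
  by move: degv A6' bal1' leI; rewrite O0 cards0; clear; lia.
have [I0 | [u]] := set_0Vmem (inN D v A).
  by move: degv A6' bal1' leO; rewrite I0 cards0; clear; lia.
rewrite !inE => /andP [uA uv] /andP [wA vw].
(* The walks [u v x t] and [u v w t] coincide. With the mirror argument for [u], the degree is at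
   most 2, while [6 <= #|A|] requires 4. *)
have subO1 : outN D v A \subset [set w].
  apply/subsetP=> x; rewrite !inE => /andP [xA vx]; apply/eqP.
  have [] // := F3_free_walk Dfree uv vx _ uv vw (y := t);
  by apply: lt_arc; rewrite ?ct ?out1.
have subI1 : inN D v A \subset [set u].
  apply/subsetP=> x; rewrite !inE => /andP [xA xv]; apply/eqP.
  have [] // := F3_free_walk Dfree _ xv vw _ uv vw (x := s);
  by apply: lt_arc; rewrite ?cs ?in1.
move: degv A6' (subset_leq_card subO1) (subset_leq_card subI1).
by rewrite !cards1; clear; lia.
Qed.

Lemma T3_on_extremal A : 6 <= #|A| -> #|A| ^ 2 %/ 3 + 1 <= arcs_in D A -> T3_on D A.
Proof.
have [n] := ubnP #|A|; elim: n A => // n IHn A ltAn A6 arcsA.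
have [A6' | A7] := leqP #|A| 6.
  have cardA : #|A| = 6 by apply/eqP; rewrite eqn_leq A6'.
  by apply: T3_on_card6 => //; rewrite cardA in arcsA.
have [|v [vA cardA degA arcsA' low]] := @exists_deletion A; first by lia.
rewrite cardA arcsA' in ltAn A7 arcsA low.
have T3' : T3_on D (A :\ v).
  apply: IHn => //; apply: deletion_bound low arcsA.
  by move: A7; clear; lia.
rewrite -(setD1K vA); apply: T3_on_extend => //; first by rewrite !inE eqxx.
by rewrite degA; apply: degree_bound (arcs_in_T3 T3') arcsA.
Qed.

End Extremal.

(** * Isomorphism invariance and the final count *)

Lemma arc_number_iso (V W : finType) (D : rel V) (H : rel W) :
  isomorphic D H -> #|W| = #|V| /\ arc_number H = arc_number D.
Proof.
case=> f fbij fE; split; first exact/esym/(bij_eq_card fbij).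
have finj := bij_inj fbij.
rewrite /arc_number.
pose g (p : V * V) := (f p.1, f p.2).
have ginj : injective g by move=> [x y] [x' y'] [/finj -> /finj ->].
rewrite -(card_imset _ ginj); apply: eq_card => -[x y].
apply/idP/imsetP => [|[[x' y']]].
  rewrite inE /=; case: fbij => f' _ f'K Hxy.
  exists (f' x, f' y); last by rewrite /g !f'K.
  by rewrite inE /= -fE !f'K.
by rewrite !inE /= => Dxy [-> ->]; rewrite fE.
Qed.

Theorem corollary3 (n : nat) (V : finType) (D : rel V)
    (card_V : #|V| = n) (n_ge16 : 16 <= n)
    (D_strict : strict D) (D_free : F3_free D) :
  arc_number D <= n ^ 2 %/ 3 + 1 /\
  (arc_number D = n ^ 2 %/ 3 + 1 <->
   exists (W : finType) (H : rel W), in_T3 n H /\ isomorphic D H).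
Proof.
have extremal : n ^ 2 %/ 3 + 1 <= arc_number D -> T3_on D [set: V].
  rewrite -arcs_in_setT -card_V -cardsT => arcsD.
  apply: T3_on_extremal => //; rewrite cardsT card_V.
  exact: leq_trans n_ge16.
split.
  (* A digraph above the bound would have the extremal structure, hence exactly the extremal number
     of arcs. *)
  rewrite leqNgt; apply/negP=> lt_D.
  have := arcs_in_T3 (extremal (ltnW lt_D)); rewrite arcs_in_setT cardsT card_V.
  by move=> arcsD; rewrite arcsD ltnn in lt_D.
split=> [arcsD | [W [H [H_T3 isoDH]]]].
  exists V, D; split; last by exists id => //; exists id.
  by apply/(in_T3P D card_V)/extremal; rewrite arcsD.
have [cardW <-] := arc_number_iso isoDH.
have {}cardW : #|W| = n by rewrite cardW.
move/(in_T3P H cardW)/arcs_in_T3: H_T3.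
by rewrite arcs_in_setT cardsT cardW.
Qed.
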